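(* Let $r \geq 3$ and $l$ be integers with $2 \leq l \leq r/2$. Then, for any finite $r$-graph $G$, $$\tau^{(r-1)}(G) \leq \frac{|D(G)|}{2}\left[\frac{1}{l} + \left(3 + \frac{r-1}{l-1}\right)\left(1 - \frac{1}{l}\right)^{r-1}\right].$$ Additionally, for any finite $r$-graph $G$ with $r \in \{3,4,5\}$, $$\tau^{(r-1)}(G) \leq \begin{cases} \frac{1}{2}|D(G)| & \text{if } r = 3,\\ \frac{4}{9}|D(G)| & \text{if } r = 4,\\ \frac{5}{16}|D(G)| & \text{if } r = 5.\end{cases}$$
   Context: An $r$-graph $G$ is a set of $r$-element subsets (edges) of a vertex set $V(G)$. An $(r-1)$-cover of $G$ is a collection of $(r-1)$-element subsets of $V(G)$ such that every edge of $G$ contains at least one member of the collection; $\tau^{(r-1)}(G)$ is the minimum size of an $(r-1)$-cover of $G$. $D(G)$ is the set of all $(r-1)$-element subsets of $V(G)$ that are contained in at least one edge of $G$. *)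

(* Defs.v *)
From mathcomp Require Import all_boot all_order all_algebra.

Set Implicit Arguments.
Unset Strict Implicit.
Unset Printing Implicit Defensive.

Section HypergraphCovers.

Variables (r : nat) (V : finType).
Implicit Types (G C : {set {set V}}) (e f : {set V}).

Definition is_rgraph G : bool := [forall e in G, #|e| == r].

Definition is_cover G C : bool :=
  [forall f in C, #|f| == r.-1] && [forall e in G, [exists f in C, f \subset e]].

Definition shadow G : {set {set V}} :=
  [set f : {set V} | (#|f| == r.-1) && [exists e in G, f \subset e]].

Lemma shadow_cover G : is_rgraph G -> is_cover G (shadow G).
Proof.
move=> /forall_inP hG; apply/andP; split.
  by apply/forall_inP => f; rewrite inE => /andP[].
apply/forall_inP => e eG; have /eqP ce := hG e eG.
have [f] : exists f, f \in [set B : {set V} | B \subset e & #|B| == r.-1].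
  by apply/card_gt0P; rewrite cards_draws ce bin_gt0 leq_pred.
rewrite inE => /andP[fe cf]; apply/exists_inP; exists f => //.
by rewrite inE cf; apply/exists_inP; exists e.
Qed.

(* The shadow is only the default value that [arg min] requires; it is itself a
   cover (shadow_cover), so for an r-graph this is a genuine minimum. *)
Definition tau G : nat := #|[arg min_(C < shadow G | is_cover G C) #|C|]|.

Lemma tau_attained G :
  is_rgraph G -> exists2 C, is_cover G C & tau G = #|C|.
Proof.
by move=> hG; rewrite /tau; case: arg_minnP => [|C hC _];
  [exact: shadow_cover | exists C].
Qed.

Lemma tau_le G C : is_rgraph G -> is_cover G C -> tau G <= #|C|.
Proof.
by move=> hG hC; rewrite /tau; case: arg_minnP => [|D _ hD];
  [exact: shadow_cover | exact: hD].
Qed.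

End HypergraphCovers.

(* Main.v *)
Require Import Defs.
From mathcomp Require Import all_boot all_order all_algebra.
From mathcomp Require Import zify ring lra.

Set Implicit Arguments.
Unset Strict Implicit.
Unset Printing Implicit Defensive.

Import Order.TTheory GRing.Theory Num.Theory.

(** All four bounds come from averaging.  Suppose that a random choice produces
a family of [(r - 1)]-sets such that every [r]-set has a member of the family
among its subsets, and such that each [(r - 1)]-set belongs to the family with
probability at most [p].  Intersecting the family with the shadow of [G] gives a
cover of [G], and its expected size is at most [p] times the size of the shadow
([tau_le_average]).  So any construction of a Turan system that is a blow-up of
a small pattern yields a bound valid relative to the shadow.  Vertices are
coloured uniformly and independently; a class of a set is the part of it that
has a given colour.

For [r = 3] the family consists of the monochromatic pairs of a 2-colouring
([p = 1/2]).  For [r = 4] it is the Turan construction on three cyclically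
ordered colours: triples that are monochromatic, or that have two vertices of
colour [i] and one of colour [i + 1] ([p = 12/27]).

The other two constructions have a further factor 1/2, obtained from random bits
as in Giraud's construction.  Attach an independent random bit to every choice
of one vertex per colour, and let the parity of [S] be the sum of the bits over
the choices made among the first two vertices of each class of [S].  If no class
of [S] is empty, this parity is a fair coin ([parity_half]).  But if a class of
[R] has at least three vertices, then removing in turn each of its first three
vertices produces three sets whose parities add up to zero, so one of
these sets has parity zero ([parity_zero_cover]): restricting to parity
zero halves the family without losing the cover property.  With two colours, the
monochromatic 4-sets together with the 2+2 sets of parity zero give [5/16] for
[r = 5].

For the general bound take [l] colours, identified with the integers modulo [l],
and a random shift [c].  The weight of a set is the sum of its colours.  Removing
a vertex of colour [w(R) - c] from [R] leaves a set of weight [c].  If that colour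
class of [R] has at least three vertices, one can reach parity zero; if it has one
or two, the remaining set has a class of size at most one; and if it is empty, one
removes instead a vertex of the next nonempty class in cyclic order, which leaves a
set whose weight [c - d] announces the length [d] of a run of consecutive empty
classes.  Hence the family consists of
- the sets of weight [c] that have parity zero or a class of size at most one;
- the sets of weight [c - d], [d > 0], that miss [d] consecutive classes.
Given the colouring, the shifts [c] that put [S] into the second part
number at most the longest run of empty classes, hence at most the number of empty
classes ([gap_count]).  With [q = 1 - 1/l] and [k = r - 1], a given class of [S] is
empty with probability [q^k] and a singleton with probability [k q^k / (l - 1)], so
[p] is at most the sum of [1/(2l)] (parity zero), of half the sum of these two
probabilities (small class, parity one) and of [q^k] (second part), which is the
stated bound. *)

(** * Averaging over random covers *)

Lemma tau_le_average (Om V : finType) (r : nat) (G : {set {set V}})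
    (F : Om -> pred {set V}) (p : rat) :
    is_rgraph r G -> (0 < #|Om|)%N ->
    (forall w (R : {set V}), #|R| = r -> exists2 x, x \in R & F w (R :\ x)) ->
    (forall S : {set V}, #|S| = r.-1 ->
       ((\sum_w F w S)%N%:R <= p * #|Om|%:R)%R) ->
  ((tau r G)%:R <= p * #|shadow r G|%:R)%R.
Proof.
move=> hG Om_gt0 cov prob.
have tauF w : tau r G <= \sum_(S in shadow r G) F w S.
  pose C := [set S in shadow r G | F w S].
  have -> : \sum_(S in shadow r G) F w S = #|C|.
    rewrite -sum1_card big_mkcond [RHS]big_mkcond /=.
    by apply: eq_bigr => S _; rewrite !inE; case: (_ && _); case: (F w S).
  apply: tau_le => //; apply/andP; split.
    by apply/forall_inP => S; rewrite inE => /andP[]; rewrite inE => /andP[].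
  apply/forall_inP => R RG; have /eqP cR := forall_inP hG R RG.
  have [x xR Fx] := cov w R cR; apply/exists_inP; exists (R :\ x); last exact: subD1set.
  have cS : #|R :\ x| == r.-1 by rewrite -cR (cardsD1 x R) xR.
  rewrite !inE cS Fx andbT /=; apply/exists_inP; exists R => //; exact: subD1set.
have : #|Om| * tau r G <= \sum_w \sum_(S in shadow r G) F w S.
  by rewrite -sum_nat_const; apply: leq_sum.
rewrite exchange_big /= -(ler_nat rat) natrM natr_sum => le1.
rewrite -(ler_pM2l (_ : 0 < #|Om|%:R)%R) ?ltr0n//; apply: (le_trans le1).
apply: (@le_trans _ _ (\sum_(S in shadow r G) (p * #|Om|%:R))%R).
  apply: ler_sum => S; rewrite inE => /andP[/eqP cS _]; exact: prob.
by rewrite sumr_const -[leLHS]mulr_natr mulrAC mulrC.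
Qed.

(** * Counting colourings *)

Lemma card_local (V C : finType) (S : {set V}) (B : V -> pred C) :
  #|[set f : {ffun V -> C} | [forall y in S, f y \in B y]]|
    = (\prod_(y in S) #|B y|) * #|C| ^ #|~: S|.
Proof.
pose B' y := if y \in S then B y else predT.
have -> : #|[set f : {ffun V -> C} | [forall y in S, f y \in B y]]|
          = #|family B'|.
  apply: eq_card => f; rewrite inE; apply/forall_inP/familyP => fB y.
    by rewrite /B'; case: ifP => // yS; apply: fB.
  by move=> yS; have := fB y; rewrite /B' yS.
rewrite card_family foldrE big_image /= (bigID (mem S)) /=.
congr (_ * _).
  by apply: eq_bigr => y yS; rewrite /B' yS.
rewrite -prod_nat_const; apply: eq_big => y; first by rewrite inE.
by rewrite /B' => /negPf->.
Qed.

Lemma card_agree (V C : finType) (S : {set V}) (g : V -> C) :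
  #|[set f : {ffun V -> C} | [forall y in S, f y == g y]]| = #|C| ^ #|~: S|.
Proof.
have := card_local S (fun y => pred1 (g y)).
rewrite (eq_bigr (fun=> 1)) ?big1_eq ?mul1n => [<-|y _]; last exact: card1.
by apply: eq_card => f; rewrite !inE.
Qed.

Lemma card_ffun_split (V C : finType) (S : {set V}) :
  #|{ffun V -> C}| = #|C| ^ #|S| * #|C| ^ #|~: S|.
Proof. by rewrite card_ffun -expnD cardsC. Qed.

Lemma sum_nat_of_pred (T : finType) (P : pred T) : \sum_w P w = #|[set w | P w]|.
Proof.
rewrite -sum1_card [RHS]big_mkcond; apply: eq_bigr => w _.
by rewrite inE; case: (P w).
Qed.

Lemma le_exists_sum (I : finType) (P : pred I) :
  ([exists i, P i] : nat) <= \sum_i P i.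
Proof.
case: existsP => //= -[i Pi].
by rewrite (bigD1 i) //= Pi leq_addr.
Qed.

Lemma le_exists_in_sum (I : finType) (Q P : pred I) :
  ([exists i in Q, P i] : nat) <= \sum_(i in Q) P i.
Proof.
case: existsP => //= -[i /andP[Qi Pi]].
by rewrite (bigD1 i) //= Pi leq_addr.
Qed.

(** * A random parity that halves a family *)

Section Parity.
Variables (V C : finType).
Implicit Types (S R X : {set V}) (f : {ffun V -> C}).

Definition cls f S i := [set x in S | f x == i].

(** Only two vertices per class are used, since then the identity behind
[parity_zero_cover] holds for classes of even size too. *)
Definition head2 X := take 2 (enum X).

Definition transversal f S : pred {ffun C -> V} :=
  [pred g : {ffun C -> V} | [forall i, g i \in head2 (cls f S i)]].

Definition parity (M : {ffun {ffun C -> V} -> bool}) f S : bool :=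
  \big[addb/false]_(g | transversal f S g) M g.

Lemma clsD1 f R x i :
  cls f (R :\ x) i = if f x == i then cls f R i :\ x else cls f R i.
Proof.
apply/setP => y; rewrite !inE; case: ifP => fx; rewrite !inE ?andbA //.
by case: (eqVneq y x) => [->|//]; rewrite fx !andbF.
Qed.

Lemma enumD1 X x : enum (X :\ x) = filter (predC1 x) (enum X).
Proof.
by rewrite /enum_mem -filter_predI; apply: eq_filter => y; rewrite !inE.
Qed.

(** Removing one of the first three vertices leaves the two others as the head:
each of the three occurs in exactly two of the three heads. *)
Lemma head2_three X : 2 < #|X| -> exists x1 x2 x3,
  [/\ uniq [:: x1; x2; x3], {subset [:: x1; x2; x3] <= X} &
   [/\ head2 (X :\ x1) = [:: x2; x3], head2 (X :\ x2) = [:: x1; x3] &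
    head2 (X :\ x3) = [:: x1; x2]]].
Proof.
rewrite /head2 cardE => szX.
case E: (enum X) szX (enum_uniq X) => [|x1 [|x2 [|x3 s]]] //= _.
rewrite !inE !negb_or -!andbA => /and5P[n12 n13 _ n23 /and3P[_ _ _]].
exists x1, x2, x3; split.
- by rewrite /= !inE !negb_or n12 n13 n23.
- by move=> y yx; rewrite -mem_enum E (mem_cat y [:: x1; x2; x3]) yx.
- rewrite !enumD1 E /= !eqxx n12 n13 n23 ![_ == x1]eq_sym ![x3 == _]eq_sym.
  by rewrite n12 n13 n23 /= !take0.
Qed.

(** Let [x1], [x2], [x3] be the first three vertices of the class [j] of [R].  A
transversal counted in one of the [R :\ xs] passes through one of these three
vertices, and so it is counted exactly twice: the three parities add up to
zero. *)
Lemma parity_zero_cover M f R j : 2 < #|cls f R j| ->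
  exists2 x, x \in cls f R j & ~~ parity M f (R :\ x).
Proof.
move=> /head2_three[x1 [x2 [x3 [xU xX [h1 h2 h3]]]]].
have tE x h g : x \in cls f R j -> head2 (cls f R j :\ x) = h ->
    transversal f (R :\ x) g
      = [forall (i | i != j), g i \in head2 (cls f R i)] && (g j \in h).
  rewrite inE => /andP[_ /eqP fx] hx; apply/forallP/andP => [gT|[/forallP gT gj] i].
    split; last by have := gT j; rewrite clsD1 fx eqxx hx.
    apply/forallP => i; apply/implyP => ij.
    by have := gT i; rewrite clsD1 fx eq_sym (negPf ij).
  rewrite clsD1 fx; case: eqVneq => [<-|ij]; first by rewrite hx.
  by have := gT i; rewrite eq_sym ij.
have x1X : x1 \in cls f R j by apply: xX; rewrite !inE eqxx.
have x2X : x2 \in cls f R j by apply: xX; rewrite !inE eqxx orbT.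
have x3X : x3 \in cls f R j by apply: xX; rewrite !inE eqxx !orbT.
have : parity M f (R :\ x1) (+) parity M f (R :\ x2) (+) parity M f (R :\ x3) = false.
  rewrite /parity (big_mkcond (transversal f (R :\ x1))).
  rewrite (big_mkcond (transversal f (R :\ x2))).
  rewrite (big_mkcond (transversal f (R :\ x3))) -!big_split big1 //= => g _.
  rewrite (tE _ _ _ x1X h1) (tE _ _ _ x2X h2) (tE _ _ _ x3X h3) !inE.
  case: [forall (_ | _), _] => //=.
  move: xU; rewrite /= !inE negb_or andbT => /andP[/andP[n12 n13] n23].
  case: (eqVneq (g j) x1) => [->|_]; first by rewrite (negPf n12) (negPf n13) addbb.
  by case: (eqVneq (g j) x2) => [->|_]; rewrite ?(negPf n23) /= ?addbF addbb.
case p1: (parity M f (R :\ x1)); case p2: (parity M f (R :\ x2)) => //= p3.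
- by exists x3; rewrite // p3.
- by exists x2; rewrite // p2.
- by exists x1; rewrite // p1.
- by exists x1; rewrite // p1.
Qed.

(** Flipping the bit at [t0] exchanges the two values of the sum. *)
Lemma addb_half (T : finType) (D : pred T) (t0 : T) : D t0 ->
  #|[set M : {ffun T -> bool} | ~~ \big[addb/false]_(t | D t) M t]| * 2
    = #|{ffun T -> bool}|.
Proof.
move=> Dt0; set A := [set M | _].
pose flip (M : {ffun T -> bool}) := [ffun t => M t (+) (t == t0)].
have flipK : involutive flip.
  by move=> M; apply/ffunP => t; rewrite !ffunE -addbA addbb addbF.
have <- : #|A| + #|~: A| = #|{ffun T -> bool}| by exact: cardsC.
rewrite muln2 -addnn; congr (_ + _).
rewrite -(card_imset _ (inv_inj flipK)); apply: eq_card => M.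
rewrite -[M in LHS]flipK mem_imset ?inE; last exact: inv_inj.
rewrite negbK (bigD1 t0) //= [in RHS](bigD1 t0) //= ffunE eqxx addbT.
rewrite addNb negbK; congr (_ (+) _); apply: eq_bigr => t /andP[_ /negPf].
by rewrite ffunE => ->; rewrite addbF.
Qed.

Lemma parity_half f S : (forall i, cls f S i != set0) ->
  #|[set M | ~~ parity M f S]| * 2 = #|{ffun {ffun C -> V} -> bool}|.
Proof.
move=> Sn0.
have [|g gP] :=
  @fin_all_exists _ (fun=> V) (fun i x => x \in head2 (cls f S i)).
  move=> i; have := Sn0 i; rewrite -card_gt0 cardE /head2.
  by case: (enum _) => // x s _; exists x; rewrite inE eqxx.
apply: (@addb_half _ (transversal f S) [ffun i => g i]).
by apply/forallP => i; rewrite ffunE.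
Qed.

End Parity.

(** * Three vertices: monochromatic pairs *)

Section Mono.
Variables (V C : finType).
Implicit Types (S R : {set V}) (f : {ffun V -> C}).

Definition mono f S := [exists i, [forall y in S, f y == i]].

Lemma mono_count S :
  \sum_(f : {ffun V -> C}) mono f S <= #|C| * #|C| ^ #|~: S|.
Proof.
apply: (@leq_trans (\sum_i \sum_(f : {ffun V -> C}) [forall y in S, f y == i])).
  by rewrite exchange_big; apply: leq_sum => f _; apply: le_exists_sum.
rewrite -sum_nat_const; apply: leq_sum => i _.
by rewrite sum_nat_of_pred card_agree.
Qed.

End Mono.

(** The vertex to remove is the only one, if any, whose colour is not [i]. *)
Lemma mono_cover (V : finType) (f : {ffun V -> bool}) (R : {set V}) i :
  0 < #|R| -> #|cls f R (~~ i)| <= 1 -> exists2 x, x \in R & mono f (R :\ x).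
Proof.
rewrite card_gt0 => /set0Pn[x0 x0R] le1.
have [x xR xP] : exists2 x, x \in R & cls f R (~~ i) \subset [set x].
  have [->|/set0Pn[x xX]] := eqVneq (cls f R (~~ i)) set0.
    by exists x0; rewrite ?sub0set.
  exists x; first by move: xX; rewrite inE => /andP[].
  suff -> : cls f R (~~ i) = [set x] by [].
  by apply/eqP; rewrite eq_sym eqEcard sub1set xX cards1.
exists x => //; apply/existsP; exists i; apply/forall_inP => y.
rewrite !inE => /andP[yx yR]; apply: contraNT yx => fy.
have := subsetP xP y; rewrite !inE yR /=; apply.
by move: fy; case: (f y) i {le1 xP} => [] [].
Qed.

Lemma cls_bool (V : finType) (f : {ffun V -> bool}) (R : {set V}) :
  #|cls f R true| + #|cls f R false| = #|R|.
Proof.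
rewrite -(cardsID [set x | f x] R); congr (_ + _); apply: eq_card => x; rewrite !inE.
  by rewrite eqb_id.
by rewrite eqbF_neg andbC.
Qed.

Lemma tau3 (V : finType) (G : {set {set V}}) : is_rgraph 3 G ->
  ((tau 3 G)%:R <= 1 / 2 * #|shadow 3 G|%:R :> rat)%R.
Proof.
move=> hG; apply: (@tau_le_average {ffun V -> bool} _ _ _ (@mono V bool)) => //.
- by rewrite card_ffun card_bool expn_gt0.
- move=> f R cR; have := cls_bool f R; rewrite cR => c3.
  have [le1|lt1] := leqP #|cls f R false| 1.
    by apply: (@mono_cover _ _ _ true); rewrite ?cR.
  by apply: (@mono_cover _ _ _ false); rewrite ?cR //=; lia.
move=> S cS; have := mono_count bool S.
rewrite (card_ffun_split bool S) cS card_bool /= => le1.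
rewrite -(ler_nat rat) in le1; apply: (le_trans le1).
by rewrite !natrM; lra.
Qed.

(** * Four vertices: the cyclic 3-colour construction *)

Section Turan.
Variable V : finType.
Implicit Types (f : {ffun V -> 'I_3}) (S R : {set V}).

Definition turan f S := mono f S ||
  [exists i, exists x in S, forall y in S, f y == (if y == x then i + 1 else i)%R].

(** [turan] read off the colours of the three vertices, so that the cover property
becomes a finite check over the colours of four vertices. *)
Definition turan_pattern (p q s : 'I_3) : bool :=
  ((q == p) && ((s == p) || (s == (p + 1)%R)))
  || ((p == s) && (q == (s + 1)%R)) || ((q == s) && (p == (q + 1)%R)).

Lemma turan_patternP (p q s t : 'I_3) :
  [|| turan_pattern p q s, turan_pattern p q t,
      turan_pattern p s t | turan_pattern q s t].
Proof.
by case: p => [[|[|[|//]]] ?]; case: q => [[|[|[|//]]] ?];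
   case: s => [[|[|[|//]]] ?]; case: t => [[|[|[|//]]] ?].
Qed.

Lemma turan_patternE f S a b c : uniq [:: a; b; c] -> S =i [:: a; b; c] ->
  turan_pattern (f a) (f b) (f c) -> turan f S.
Proof.
rewrite /= !inE negb_or andbT => /andP[/andP[nab nac] nbc] SE.
have aS : a \in S by rewrite SE !inE eqxx.
have bS : b \in S by rewrite SE !inE eqxx orbT.
have cS : c \in S by rewrite SE !inE eqxx !orbT.
have S3 (P : pred V) : P a -> P b -> P c -> [forall y in S, P y].
  by move=> *; apply/forall_inP => y; rewrite SE !inE => /or3P[]/eqP->.
case/orP=> [/orP[/andP[/eqP ba /orP[]/eqP ca]|/andP[/eqP ac /eqP bc]]
           |/andP[/eqP bc /eqP ab]].
- apply/orP; left; apply/existsP; exists (f a); apply: S3; rewrite ?ba ?ca //.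
- apply/orP; right; apply/existsP; exists (f a); apply/exists_inP; exists c => //.
  by apply: S3; rewrite ?eqxx ?(negPf nac) ?(negPf nbc) ?ba ?ca.
- apply/orP; right; apply/existsP; exists (f c); apply/exists_inP; exists b => //.
  by apply: S3; rewrite ?eqxx ?(negPf nab) ?[c == b]eq_sym ?(negPf nbc) ?bc ?ac.
- apply/orP; right; apply/existsP; exists (f b); apply/exists_inP; exists a => //.
  by apply: S3; rewrite ?eqxx ?[_ == a]eq_sym ?(negPf nab) ?(negPf nac) ?ab ?bc.
Qed.

Lemma turan_cover f R : #|R| = 4 -> exists2 x, x \in R & turan f (R :\ x).
Proof.
rewrite cardE; have := mem_enum R; have := enum_uniq R.
case: (enum R) => [|a [|b [|c [|d []]]]] // U RE _.
have mR x : x \in [:: a; b; c; d] -> x \in R by rewrite RE.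
have := turan_patternP (f a) (f b) (f c) (f d).
have E x s : perm_eq (x :: s) [:: a; b; c; d] -> uniq s /\ R :\ x =i s.
  move=> ps; have := perm_uniq ps; rewrite U => /andP[xs us]; split=> // y.
  rewrite !inE -RE -(perm_mem ps) inE; case: eqVneq => //= ->.
  by rewrite (negPf xs).
case/or4P => H.
- exists d; first by apply: mR; rewrite !inE eqxx !orbT.
  have [|? ?] := E d [:: a; b; c]; last exact: turan_patternE H.
  by apply/permP => P /=; lia.
- exists c; first by apply: mR; rewrite !inE eqxx !orbT.
  have [|? ?] := E c [:: a; b; d]; last exact: turan_patternE H.
  by apply/permP => P /=; lia.
- exists b; first by apply: mR; rewrite !inE eqxx !orbT.
  have [|? ?] := E b [:: a; c; d]; last exact: turan_patternE H.
  by apply/permP => P /=; lia.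
- exists a; first by apply: mR; rewrite !inE eqxx.
  have [|? ?] := E a [:: b; c; d]; last exact: turan_patternE H.
  by [].
Qed.

(** For each colour [i] there is one monochromatic pattern, and one pattern for
each choice of the vertex of colour [i + 1]. *)
Lemma turan_count S : \sum_f turan f S <= 3 * #|S|.+1 * 3 ^ #|~: S|.
Proof.
pose odd_one f : nat := \sum_i \sum_(x in S)
  [forall y in S, f y == (if y == x then i + 1 else i)%R].
apply: (@leq_trans (\sum_f (mono f S + odd_one f))).
  apply: leq_sum => f _; rewrite /turan; case: (mono f S) => //=.
  apply: (leq_trans (le_exists_sum _)); apply: leq_sum => i _.
  exact: le_exists_in_sum.
rewrite big_split mulnS mulnDl; apply: leq_add.
  by have := mono_count 'I_3 S; rewrite card_ord.
rewrite exchange_big /= -mulnA -[X in X * (_ * _)]card_ord -[leqRHS]sum_nat_const.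
apply: leq_sum => i _; rewrite exchange_big /= -sum_nat_const.
by apply: leq_sum => x _; rewrite sum_nat_of_pred card_agree card_ord.
Qed.

End Turan.

Lemma tau4 (V : finType) (G : {set {set V}}) : is_rgraph 4 G ->
  ((tau 4 G)%:R <= 4 / 9 * #|shadow 4 G|%:R :> rat)%R.
Proof.
move=> hG; apply: (@tau_le_average {ffun V -> 'I_3} _ _ _ (@turan V)) => //.
- by rewrite card_ffun card_ord expn_gt0.
- by move=> f R cR; apply: turan_cover.
move=> S cS; have := turan_count S.
rewrite (card_ffun_split 'I_3 S) cS card_ord /= => le1.
rewrite -(ler_nat rat) in le1; apply: (le_trans le1).
by rewrite !natrM; lra.
Qed.

(** * Five vertices: two colours and parity *)

Section Giraud.
Variable V : finType.
Implicit Types (f : {ffun V -> bool}) (S R : {set V}).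

Definition giraud (w : {ffun V -> bool} * {ffun {ffun bool -> V} -> bool}) S :=
  mono w.1 S || (#|cls w.1 S true| == 2) && ~~ parity w.2 w.1 S.

(** If both classes have at least two vertices, their sizes are 2 and 3, and removing
a vertex of the larger one leaves two vertices in each. *)
Lemma giraud_cover w R : #|R| = 5 -> exists2 x, x \in R & giraud w (R :\ x).
Proof.
case: w => f M cR; have := cls_bool f R; rewrite cR => c5; rewrite /giraud /=.
have mon i : #|cls f R (~~ i)| <= 1 ->
    exists2 x, x \in R & mono f (R :\ x) ||
      (#|cls f (R :\ x) true| == 2) && ~~ parity M f (R :\ x).
  move=> le1; have [|x xR xm] := mono_cover _ le1; first by rewrite cR.
  by exists x => //; rewrite xm.
have [le1|gt1] := leqP #|cls f R false| 1; first exact: (mon true).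
have [le1|gt1'] := leqP #|cls f R true| 1; first exact: (mon false).
have [c3|c3] : #|cls f R true| = 3 \/ #|cls f R true| = 2 by lia.
  have [|x xX par] := @parity_zero_cover _ _ M f R true; first by rewrite c3.
  have /andP[xR fx] : (x \in R) && (f x == true) by rewrite inE in xX.
  exists x; rewrite // par andbT clsD1 fx.
  by have := cardsD1 x (cls f R true); rewrite xX c3 add1n => -[<-]; rewrite orbT.
have [|x xX par] := @parity_zero_cover _ _ M f R false; first by lia.
have /andP[xR /eqP fx] : (x \in R) && (f x == false) by rewrite inE in xX.
by exists x; rewrite // par andbT clsD1 fx /= c3 orbT.
Qed.

(** There are two monochromatic patterns and six balanced ones; parity counts the
latter by half, so that five of the sixteen patterns remain. *)
Lemma giraud_count S : #|S| = 4 ->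
  16 * \sum_w giraud w S <=
    5 * #|{: {ffun V -> bool} * {ffun {ffun bool -> V} -> bool} }|.
Proof.
move=> cS; set N := #|{ffun {ffun bool -> V} -> bool}|.
have two : \sum_(f : {ffun V -> bool}) (#|cls f S true| == 2) <= 6 * 2 ^ #|~: S|.
  pose D := [set T : {set V} | T \subset S & #|T| == 2].
  have <- : #|D| = 6 by rewrite cards_draws cS.
  apply: (@leq_trans (\sum_(f : {ffun V -> bool}) \sum_(T in D)
    [forall y in S, f y == (y \in T)])).
    apply: leq_sum => f _; case: eqP => // c2.
    rewrite (bigD1 (cls f S true)) /=; last first.
      by rewrite inE c2 eqxx andbT; apply/subsetP => x; rewrite inE => /andP[].
    suff -> : [forall y in S, f y == (y \in cls f S true)] by [].
    by apply/forall_inP => y yS; rewrite inE yS eqb_id.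
  rewrite exchange_big -sum_nat_const; apply: leq_sum => T _ /=.
  by rewrite sum_nat_of_pred card_agree card_bool.
have perf f : 2 * \sum_M giraud (f, M) S <= N * (2 * mono f S + (#|cls f S true| == 2)).
  rewrite /giraud /=; case: (boolP (mono f S)) => [_|nm] /=.
    rewrite sum_nat_const -/N; lia.
  case: eqP => [c2|_] /=; last by rewrite big1.
  rewrite sum_nat_of_pred muln1 mulnC parity_half //.
  move=> i; rewrite -card_gt0; have := cls_bool f S; rewrite cS c2.
  by case: i; lia.
rewrite card_prod -/N (card_ffun_split bool S) cS card_bool.
rewrite -(pair_bigA _ (fun f M => giraud (f, M) S : nat)) /=.
have : 2 * \sum_f \sum_M giraud (f, M) S <=
    N * (2 * \sum_(f : {ffun V -> bool}) mono f S
         + \sum_(f : {ffun V -> bool}) (#|cls f S true| == 2)).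
  by rewrite !big_distrr -big_split /= big_distrr; apply: leq_sum => f _; exact: perf.
have := mono_count bool S; rewrite card_bool.
move: two; set a := \sum_f _; set b := \sum_f _; set c := \sum_f _; set e := 2 ^ _.
move=> ha hb hc.
have : N * (2 * c + b) <= N * (10 * e) by rewrite leq_mul2l; apply/orP; right; lia.
have -> : 2 ^ 4 = 16 by [].
nia.
Qed.

End Giraud.

Lemma tau5 (V : finType) (G : {set {set V}}) : is_rgraph 5 G ->
  ((tau 5 G)%:R <= 5 / 16 * #|shadow 5 G|%:R :> rat)%R.
Proof.
move=> hG; apply: (tau_le_average (F := @giraud V)) => //.
- by rewrite card_prod !card_ffun card_bool muln_gt0 !expn_gt0.
- by move=> w R cR; apply: giraud_cover.
move=> S cS; have := giraud_count cS.
rewrite -(ler_nat rat) !natrM; lra.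
Qed.

(** * The general construction: cyclic weights *)

Section General.
Variables (n : nat) (V : finType).
Local Notation color := 'I_n.+1.
Implicit Types (f : {ffun V -> color}) (S R : {set V}).

Definition weight f S : color := (\sum_(x in S) f x)%R.

Definition sparse f S := [exists i, #|cls f S i| <= 1].

Definition gap f S (d : color) :=
  [exists j, [forall s : color, (s < d) ==> (cls f S (j + s)%R == set0)]].

(** The weight of [S] is [c - d]; the value [d = 0] marks the first part of the
family and any other value is the length of a run of missing colours. *)
Definition selected
    (w : {ffun V -> color} * color * {ffun {ffun color -> V} -> bool}) S :=
  let d := (w.1.2 - weight w.1.1 S)%R in
  if d == 0%R then sparse w.1.1 S || ~~ parity w.2 w.1.1 S else gap w.1.1 S d.

Lemma weightD1 f R x : x \in R -> weight f (R :\ x) = (weight f R - f x)%R.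
Proof. by move=> xR; rewrite /weight (big_setD1 x xR) /= addrAC subrr add0r. Qed.

(** Removing a vertex of colour [j] from [R] leaves a set of weight [c]. *)
Lemma selected_cover w R : 0 < #|R| -> exists2 x, x \in R & selected w (R :\ x).
Proof.
case: w => [[f c] M] R0; pose j := (weight f R - c)%R.
have dE x : x \in R -> (c - weight f (R :\ x) = f x - j)%R.
  by move=> xR; rewrite weightD1 // /j !opprB addrCA.
have [gt2|le2] := ltnP 2 #|cls f R j|.
  have [x xX par] := parity_zero_cover M gt2.
  have /andP[xR /eqP fx] : (x \in R) && (f x == j) by rewrite inE in xX.
  by exists x; rewrite // /selected /= dE // fx subrr eqxx par orbT.
have [j0|/set0Pn[x xX]] := eqVneq (cls f R j) set0; last first.
  have /andP[xR /eqP fx] : (x \in R) && (f x == j) by rewrite inE in xX.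
  exists x; rewrite // /selected /= dE // fx subrr eqxx.
  apply/orP; left; apply/existsP; exists j; rewrite clsD1 fx eqxx.
  by move: le2; rewrite (cardsD1 x) xX add1n ltnS.
(* The class [j] is empty: take the nearest nonempty class after it. *)
have [x0 x0R] : exists x, x \in R by apply/card_gt0P.
case: (@arg_minnP _ x0 (mem R) (fun x => (f x - j)%R : nat) x0R) => x memR xmin.
have xR : x \in R by exact: memR.
exists x; rewrite // /selected /= dE //; case: ifP => [|_].
  rewrite subr_eq0 => /eqP fx.
  by have := in_set0 x; rewrite -j0 inE xR fx eqxx.
apply/existsP; exists j; apply/forallP => s; apply/implyP => sx.
apply/eqP/setP => y; rewrite !inE; apply/negP => /andP[/andP[_ yR] /eqP fy].
have := xmin y yR; rewrite fy addrAC subrr add0r.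
by rewrite leqNgt sx.
Qed.

(** If [m] is the largest such [d] and the run of length [m] starts at [j], then
[d] is sent injectively to the empty class [j + (d - 1)]. *)
Lemma gap_count f S :
  #|[set d | (d != 0%R) && gap f S d]| <= #|[set i | cls f S i == set0]|.
Proof.
set D := [set d | _].
have [->|/set0Pn[d0 d0D]] := eqVneq D set0; first by rewrite cards0.
case: (@arg_maxnP _ d0 (mem D) (fun d : color => d : nat) d0D) => m memD mmax.
have mD : m \in D by exact: memD.
have /existsP[j /forallP gj] : gap f S m by move: mD; rewrite inE => /andP[].
have D_gt0 (d : color) : d \in D -> 0 < d.
  by rewrite inE => /andP[d_n0 _]; rewrite lt0n.
pose h (d : color) : color := (j + inord d.-1)%R.
have predK (d : color) : (inord d.-1 : color) = d.-1 :> nat.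
  by apply: inordK; apply: leq_ltn_trans (leq_pred d) (ltn_ord d).
have hI : {in D &, injective h}.
  move=> d d' /D_gt0 dD /D_gt0 d'D /addrI /(congr1 val) /=; rewrite !predK => dd.
  by apply: val_inj => /=; rewrite -(prednK dD) dd prednK.
rewrite -(card_in_imset hI); apply: subset_leq_card.
apply/subsetP => _ /imsetP[d dD ->].
rewrite inE; apply: (implyP (gj _)); rewrite predK prednK ?D_gt0 //; exact: mmax.
Qed.

Lemma count_empty S i :
  \sum_(f : {ffun V -> color}) (cls f S i == set0) = n ^ #|S| * n.+1 ^ #|~: S|.
Proof.
rewrite sum_nat_of_pred.
have := card_local S (fun=> predC1 i); rewrite prod_nat_const cardC1 card_ord => <-.
apply: eq_card => f; rewrite !inE; apply/eqP/forall_inP => [c0 y yS|fS].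
  by have := in_set0 y; rewrite -c0 !inE yS /= => ->.
by apply/setP => y; rewrite !inE; apply/negP => /andP[/fS]; rewrite !inE => /negP.
Qed.

(** The bound is a union over the vertex [x] that forms the class; the other
vertices avoid the colour. *)
Lemma count_single S i :
  \sum_(f : {ffun V -> color}) (#|cls f S i| == 1) <=
    #|S| * n ^ #|S|.-1 * n.+1 ^ #|~: S|.
Proof.
pose B (x y : V) : pred color := if y == x then pred1 i else predC1 i.
apply: (@leq_trans (\sum_(f : {ffun V -> color}) \sum_(x in S)
    [forall y in S, f y \in B x y])).
  apply: leq_sum => f _; case: cards1P => //= -[x cx].
  have /andP[xS fx] : (x \in S) && (f x == i) by have := set11 x; rewrite -cx inE.
  rewrite (bigD1 x) //=.
  suff -> : [forall y in S, f y \in B x y] by [].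
  apply/forall_inP => y yS; have /setP/(_ y) := cx; rewrite !inE yS /B /=.
  by case: (y == x) => /=; rewrite !inE => ->.
rewrite exchange_big /= -mulnA -sum_nat_const; apply: leq_sum => x xS.
rewrite sum_nat_of_pred card_local card_ord leq_mul2r; apply/orP; right.
rewrite (bigD1 x) //= /B eqxx card1 mul1n.
rewrite (eq_bigr (fun=> n)) => [|y /andP[_ /negPf ->]]; last by rewrite cardC1 card_ord.
rewrite prod_nat_const (cardD1 x S) xS /=.
rewrite leq_eqVlt; apply/orP; left; apply/eqP; congr (_ ^ _).
by apply: eq_card => y; rewrite !inE andbC.
Qed.

(** For a fixed colouring, divide the number of pairs (shift, bits) selecting [S] by
the number of choices of the bits: twice the result is at most one, plus one if some
class has at most one vertex, plus twice the number of empty classes.  Bounding the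
middle term by the number of classes with at most one vertex leaves three units per
empty class and one per singleton. *)
Lemma selected_count S :
  2 * \sum_w selected w S <=
    #|{ffun {ffun color -> V} -> bool}|
     * (n.+1 ^ #|S| + n.+1 * (3 * n ^ #|S| + #|S| * n ^ #|S|.-1)) * n.+1 ^ #|~: S|.
Proof.
set N := #|{ffun {ffun color -> V} -> bool}|.
have perf f : 2 * \sum_c \sum_M selected (f, c, M) S <=
    N * (1 + \sum_i (3 * (cls f S i == set0) + (#|cls f S i| == 1))).
  (* The new summation index is the gap length [d = c - weight f S]. *)
  rewrite (reindex_inj (addrI (weight f S))) /selected /=.
  under eq_bigr => d _.
    have -> : (weight f S + d - weight f S = d)%R by rewrite addrAC subrr add0r.
    over.
  rewrite (bigD1 0%R) //=.
  set rest := \sum_(_ < _ | _) _.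
  have restE : rest <= N * #|[set i | cls f S i == set0]|.
    apply: leq_trans (leq_mul (leqnn N) (gap_count f S)).
    rewrite mulnC -sum_nat_const /rest big_mkcond [leqRHS]big_mkcond /=.
    apply: leq_sum => d _; rewrite inE; case: ifP => //= /negPf->.
    by rewrite sum_nat_const -/N; case: gap; rewrite ?muln1 ?muln0.
  have halfE : 2 * \sum_(M : {ffun {ffun color -> V} -> bool})
      (sparse f S || ~~ parity M f S) <= N * (1 + sparse f S).
    case: (boolP (sparse f S)) => [_|nsp] /=.
      by rewrite sum_nat_const -/N; lia.
    rewrite sum_nat_of_pred mulnC parity_half ?addn0 ?muln1 // => i.
    move: nsp; rewrite negb_exists => /forallP/(_ i); rewrite -ltnNge -card_gt0.
    exact: ltn_trans.
  have sparseE : sparse f S <= \sum_i ((cls f S i == set0) + (#|cls f S i| == 1)).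
    apply: leq_trans (le_exists_sum _) _; apply: leq_sum => i _.
    by rewrite -cards_eq0; case: #|_| => [|[]].
  move: restE halfE sparseE.
  have -> : \sum_i (3 * (cls f S i == set0) + (#|cls f S i| == 1))
    = 2 * #|[set i | cls f S i == set0]|
      + \sum_i ((cls f S i == set0) + (#|cls f S i| == 1)).
    rewrite -sum_nat_of_pred big_distrr -big_split; apply: eq_bigr => i _.
    by rewrite /= addnA -mulSnr.
  set z := #|[set _ | _]|; set s := \sum_(_ < _) _; move=> restE halfE sparseE.
  have := leq_mul (leqnn N) sparseE.
  move: (\sum_(M : {ffun {ffun color -> V} -> bool}) _) halfE => a.
  by move: (nat_of_bool _) => b; nia.
have tot : \sum_(f : {ffun V -> color})
      (1 + \sum_i (3 * (cls f S i == set0) + (#|cls f S i| == 1)))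
    <= (n.+1 ^ #|S| + n.+1 * (3 * n ^ #|S| + #|S| * n ^ #|S|.-1)) * n.+1 ^ #|~: S|.
  rewrite big_split /= sum1_card (card_ffun_split color S) card_ord mulnDl leq_add2l.
  rewrite exchange_big /= -mulnA -[X in X * (_ * _)](card_ord n.+1).
  rewrite -[leqRHS]sum_nat_const.
  apply: leq_sum => i _; rewrite big_split -big_distrr /= count_empty mulnDl -!mulnA.
  by rewrite leq_add2l mulnA; apply: count_single.
rewrite -(pair_bigA _ (fun fc M => selected (fc, M) S : nat)) /=.
rewrite -(pair_bigA _ (fun f c => \sum_M selected (f, c, M) S)) /=.
rewrite -mulnA; apply: leq_trans (leq_mul (leqnn N) tot).
by rewrite !big_distrr; apply: leq_sum => f _; exact: perf.
Qed.

End General.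

Lemma tau_le_cyclic (r n : nat) (V : finType) (G : {set {set V}}) :
    1 < r -> 0 < n -> is_rgraph r G ->
  ((tau r G)%:R <= 1 / 2 *
    (1 / n.+1%:R + (3 + (r%:R - 1) / n%:R) * (1 - 1 / n.+1%:R) ^+ (r - 1))
    * #|shadow r G|%:R :> rat)%R.
Proof.
move=> r_gt1 n_gt0 hG; apply: (tau_le_average (F := @selected n V)) => //.
- by rewrite !card_prod !card_ffun card_bool card_ord !muln_gt0 !expn_gt0.
- by move=> w R cR; apply: selected_cover; rewrite cR ltnW.
move=> S cS; have := selected_count n S.
rewrite !card_prod (card_ffun_split _ S) !card_ord cS subn1.
case: r r_gt1 {hG cS} => [//|[//|k]] _ /=.
move: (\sum_w _) #|_| (_ ^ #|~: S|) => A N e.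
rewrite -(ler_nat rat) !(natrM, natrD, natrX) => le2.
rewrite -(ler_pM2l (ltr0Sn rat 1)); apply: (le_trans le2).
have n0 : (n%:R != 0 :> rat)%R by rewrite pnatr_eq0 -lt0n.
have l0 : (n%:R + 1 != 0 :> rat)%R by rewrite natr1 pnatr_eq0.
rewrite -!natr1 !(exprS _ k).
have -> : (1 - 1 / (n%:R + 1) = n%:R / (n%:R + 1) :> rat)%R by field.
rewrite expr_div_n le_eqVlt; apply/orP; left; apply/eqP; field.
by rewrite n0 l0 expf_neq0.
Qed.

(** * The theorem *)

Local Open Scope ring_scope.

Theorem theorem1p11 :
  (forall r l : nat, (3 <= r)%N -> (2 <= l)%N -> l%:R <= r%:R / 2 :> rat ->
     forall (V : finType) (G : {set {set V}}), is_rgraph r G ->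
     (tau r G)%:R <=
       #|shadow r G|%:R / 2 *
       (1 / l%:R + (3 + (r%:R - 1) / (l%:R - 1)) * (1 - 1 / l%:R) ^+ (r - 1))
       :> rat)
  /\
  (forall (r : nat) (V : finType) (G : {set {set V}}), is_rgraph r G ->
     [/\ r = 3%N -> (tau r G)%:R <= 1 / 2 * #|shadow r G|%:R :> rat,
         r = 4%N -> (tau r G)%:R <= 4 / 9 * #|shadow r G|%:R :> rat &
         r = 5%N -> (tau r G)%:R <= 5 / 16 * #|shadow r G|%:R :> rat]).
Proof.
split=> [r l r_ge3 l_ge2 _ V G hG | r V G hG].
  case: l l_ge2 => [//|n] n_gt0.
  have := tau_le_cyclic (ltnW r_ge3) (n_gt0 : (0 < n)%N) hG.
  rewrite -[X in (_ / (X - 1))%R]natr1 addrK => le1.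
  apply: (le_trans le1); rewrite le_eqVlt; apply/orP; left; apply/eqP; ring.
by split=> r_eq; move: hG; rewrite r_eq; [apply: tau3 | apply: tau4 | apply: tau5].
Qed.
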